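(* Let $\ell\ge2$ and $k\in I=\{0,1,\dots,\ell\}$. For the weight system of the irreducible highest weight module $V(\Lambda_k)$ in type $C^{(1)}_\ell$: (1) $\max(\Lambda_k)\cap\mathsf P^+=\{\Lambda_k+\xi_{k,\pm i}-\tfrac i2\delta \mid k\pm i\in I,\ i \text{ an even nonnegative integer}\}$ (where the sign in $\xi_{k,\pm i}$ is the same as that in $k\pm i$, and both signs are allowed); and (2) $\mu$ is a weight of $V(\Lambda_k)$ if and only if $\mu=w\eta-m\delta$ for some $w\in\mathsf W$, $\eta\in\max(\Lambda_k)\cap\mathsf P^+$ and $m\in\mathbb Z_{\ge0}$.
   Context: Let $\ell\ge2$, $I=\{0,1,\dots,\ell\}$, and let $\mathsf A=(a_{ij})_{i,j\in I}$ be the affine Cartan matrix of type $C^{(1)}_\ell$: $a_{ii}=2$, $a_{01}=-1$, $a_{10}=-2$, $a_{\ell,\ell-1}=-1$, $a_{\ell-1,\ell}=-2$, $a_{j,j+1}=a_{j+1,j}=-1$ for $1\le j\le \ell-2$, all other entries $0$. Simple roots are $\alpha_i$, simple coroots $\alpha_i^\vee$, fundamental weights $\Lambda_i$ $(i\in I)$, with $\langle \alpha_i^\vee,\alpha_j\rangle=a_{ij}$ and $\langle\alpha_i^\vee,\Lambda_j\rangle=\delta_{ij}$. The null root is $\delta=\alpha_0+2\alpha_1+\dots+2\alpha_{\ell-1}+\alpha_\ell$; the weight lattice is $\mathsf P=\bigoplus_i\mathbb Z\Lambda_i\oplus\mathbb Z\delta$; $\mathsf P^+=\{\Lambda\in\mathsf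 P:\langle\alpha_i^\vee,\Lambda\rangle\ge0\ \forall i\in I\}$. The Weyl group $\mathsf W$ is generated by $r_i$, $r_i\Lambda=\Lambda-\langle \alpha_i^\vee,\Lambda\rangle\alpha_i$ for $\Lambda\in\mathsf P$. $V(\Lambda)$ denotes the irreducible highest weight module of highest weight $\Lambda\in\mathsf P^+$ over the affine Kac--Moody algebra $\mathfrak g(\mathsf A)$ (equivalently, over its quantum group). A weight $\mu$ of $V(\Lambda)$ is maximal if $\mu+\delta$ is not a weight of $V(\Lambda)$; $\max(\Lambda)$ is the set of all maximal weights of $V(\Lambda)$. For $k\in I$ put $\xi_{k,0}=0$, and for integers $i\ge1$: if $k+i\in I$, $\xi_{k,i}=\sum_{t=1}^{i-1}t\,\alpha_{k+t}+i\sum_{j=k+i}^{\ell-1}\alpha_j+\frac i2\alpha_\ell$; if $k-i\in I$, $\xi_{k,-i}=\sum_{t=1}^{i-1}t\,\alpha_{k-t}+i\sum_{j=1}^{k-i}\alpha_j+\frac i2\alpha_0$ (empty sums are $0$). *)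

(* Defs.v *)
From HB Require Import structures.
From mathcomp Require Import all_boot all_order all_algebra.
From mathcomp Require Import boolp classical_sets.
From mathcomp Require Import zify.
Set Implicit Arguments.
Unset Strict Implicit.
Unset Printing Implicit Defensive.
Import Order.TTheory GRing.Theory Num.Theory.
Local Open Scope ring_scope.
Local Open Scope classical_set_scope.

Definition cartanC (l : nat) : 'M[int]_l.+1 :=
  \matrix_(i, j)
    if i == j then 2
    else if (i == 1 :> nat) && (j == 0 :> nat) then -2
    else if (i.+1 == l) && (j == l :> nat) then -2
    else if (i.+1 == j) || (j.+1 == i) then -1
    else 0.

(** The Cartan subalgebra h is the space of column vectors in the basis
    (alpha_0^vee, ..., alpha_l^vee, d), where d is the scaling element:
    <d, alpha_j> = 1 if j = 0 and 0 otherwise.  Its dual h^* is the space of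
    row vectors in the dual basis, which is (Lambda_0, ..., Lambda_l, delta)
    (see null_rootE), with the normalisation <d, Lambda_i> = 0. *)
Notation cartan F l := 'cV[F]_(l.+1 + 1).
Notation cartan_dual F l := 'rV[F]_(l.+1 + 1).

Section Weights.
Variables (F : numFieldType) (l : nat).
Implicit Types (i j k : 'I_l.+1) (h : cartan F l) (mu : cartan_dual F l).

Definition pairing h mu : F := (mu *m h) 0 0.

Definition coroot i : cartan F l := col_mx (delta_mx i 0) 0.

Definition simple_root j : cartan_dual F l :=
  row_mx (\row_i (cartanC l i j)%:~R) (const_mx (j == ord0)%:R).

Definition fund_weight i : cartan_dual F l := row_mx (delta_mx 0 i) 0.

Definition null_root : cartan_dual F l :=
  simple_root ord0 + 2 *: (\sum_(1 <= j < l) simple_root (inord j))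
  + simple_root ord_max.

Definition weight_lattice : set (cartan_dual F l) :=
  [set mu | exists (c : 'I_l.+1 -> int) (z : int),
     mu = \sum_i (c i)%:~R *: fund_weight i + z%:~R *: null_root].

Definition dominant_weights : set (cartan_dual F l) :=
  [set mu | weight_lattice mu /\ forall i, 0 <= pairing (coroot i) mu].

Definition reflection i mu : cartan_dual F l :=
  mu - pairing (coroot i) mu *: simple_root i.

(** Each reflection is an involution, so the products of reflections already
    form a group. *)
Inductive weyl_group : set (cartan_dual F l -> cartan_dual F l) :=
| weyl_id : weyl_group id
| weyl_reflection i w : weyl_group w -> weyl_group (reflection i \o w).

(** Only meaningful when k + n lies in {0, ..., l}; the arguments of inord are
    then at most l. *)
Definition xi k (n : int) : cartan_dual F l :=
  match n with
  | Posz 0 => 0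
  | Posz i =>
      \sum_(1 <= t < i) t%:R *: simple_root (inord (k + t))
      + i%:R *: (\sum_(k + i <= j < l) simple_root (inord j))
      + (i%:R / 2) *: simple_root ord_max
  | Negz i' => let i := i'.+1 in
      \sum_(1 <= t < i) t%:R *: simple_root (inord (k - t))
      + i%:R *: (\sum_(1 <= j < (k - i).+1) simple_root (inord j))
      + (i%:R / 2) *: simple_root ord0
  end.

End Weights.

Arguments fund_weight F {l} i.
Arguments null_root F l : clear implicits.
Arguments weight_lattice F l : clear implicits.
Arguments dominant_weights F l : clear implicits.
Arguments weyl_group F l : clear implicits.
Arguments xi F {l} k n.

Lemma cartanC_partial_sum (l : nat) (i : 'I_l.+1) (n : nat) :
  (1 < l)%N -> (0 < n <= l)%N ->
  cartanC l i ord0 + 2 * (\sum_(1 <= j < n) cartanC l i (inord j))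
  = if n == i then -2 else if n == i.+1 then 2 else 0.
Proof.
move=> l_gt1; elim: n => // n IHn /andP[_ n_lt].
have [->|n_gt0] := posnP n.
  rewrite big_geq // mulr0 addr0 !mxE /= -val_eqE /=.
  have := ltn_ord i; do ![case: eqP => //=]; lia.
rewrite big_nat_recr //= mulrDr addrA IHn; last by rewrite n_gt0 ltnW.
rewrite !mxE -val_eqE /= inordK ?ltnS 1?ltnW //.
have := ltn_ord i; do ![case: eqP => //=]; lia.
Qed.

Lemma simple_root_lshift (F : numFieldType) (l : nat) (i j : 'I_l.+1) :
  simple_root F j 0 (lshift 1 i) = (cartanC l i j)%:~R.
Proof. by rewrite row_mxEl mxE. Qed.

Lemma simple_root_rshift (F : numFieldType) (l : nat) (i : 'I_1) (j : 'I_l.+1) :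
  simple_root F j 0 (rshift l.+1 i) = (j == ord0)%:R.
Proof. by rewrite row_mxEr mxE. Qed.

Lemma null_rootE (F : numFieldType) (l : nat) :
  (1 < l)%N -> null_root F l = row_mx 0 (const_mx 1).
Proof.
move=> l_gt1.
have coordE c : null_root F l 0 c = simple_root F ord0 0 c
    + 2 * (\sum_(1 <= j < l) simple_root F (inord j) 0 c)
    + simple_root F ord_max 0 c.
  rewrite mxE; congr (_ + _); rewrite mxE; congr (_ + _).
  by rewrite mxE summxE.
apply/rowP => c; rewrite coordE; case: (split_ordP c) => i -> {c}.
  rewrite !simple_root_lshift.
  under eq_bigr do rewrite simple_root_lshift.
  rewrite -(rmorph_sum (intr : int -> F)) /=.
  rewrite -[2]/(2%:~R) -intrM -!intrD cartanC_partial_sum ?leqnn ?andbT //;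
    last by rewrite ltnW.
  rewrite mxE -val_eqE (_ : _ + _ = 0 :> int) /=;
    first by rewrite row_mxEl mxE.
  have := ltn_ord i; do ![case: eqP => //=]; lia.
rewrite [RHS]row_mxEr [RHS]mxE !simple_root_rshift.
rewrite big_nat big1 => [|j /andP[j0 jl]].
  have l_neq0 : ord_max != ord0 :> 'I_l.+1 by rewrite -val_eqE -lt0n ltnW.
  by rewrite mulr0 addr0 eqxx (negPf l_neq0) addr0.
rewrite simple_root_rshift -val_eqE /= inordK; last by rewrite ltnS ltnW.
by case: j j0 jl.
Qed.

Section Modules.
Variables (F : numFieldType) (l : nat).

Definition bracket (V : zmodType) (x y : V -> V) : V -> V :=
  fun v => x (y v) - y (x v).

(** A module over the Kac-Moody algebra g(A), which is presented by the
    Chevalley generators e_i, f_i, the elements h of the Cartan subalgebra, and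
    the Chevalley-Serre relations.  As A is symmetrizable, this presentation
    agrees with Kac's definition of g(A) (Gabber-Kac). *)
Record km_module (V : lmodType F) := KMModule {
  act_e : 'I_l.+1 -> {linear V -> V};
  act_f : 'I_l.+1 -> {linear V -> V};
  act_h : cartan F l -> {linear V -> V};
  act_h_linear : forall a h h' v,
    act_h (a *: h + h') v = a *: act_h h v + act_h h' v;
  act_hh : forall h h' v, bracket (act_h h) (act_h h') v = 0;
  act_ef : forall i j v,
    bracket (act_e i) (act_f j) v = if i == j then act_h (coroot F i) v else 0;
  act_he : forall h i v,
    bracket (act_h h) (act_e i) v = pairing h (simple_root F i) *: act_e i v;
  act_hf : forall h i v,
    bracket (act_h h) (act_f i) v = - pairing h (simple_root F i) *: act_f i v;
  act_serre_e : forall i j v, i != j ->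
    iter `|1 - cartanC l i j|%N (bracket (act_e i)) (act_e j) v = 0;
  act_serre_f : forall i j v, i != j ->
    iter `|1 - cartanC l i j|%N (bracket (act_f i)) (act_f j) v = 0
}.

Variables (V : lmodType F) (M : km_module V).
Implicit Types (U : set V) (mu : cartan_dual F l).

Definition submodule U : Prop :=
  [/\ U 0,
      forall a u v, U u -> U v -> U (a *: u + v),
      forall i v, U v -> U (act_e M i v),
      forall i v, U v -> U (act_f M i v) &
      forall h v, U v -> U (act_h M h v)].

Definition irreducible_module : Prop :=
  (exists v : V, v != 0) /\
  forall U, submodule U -> U = [set 0] \/ U = setT.

Definition weight_space mu : set V :=
  [set v | forall h, act_h M h v = pairing h mu *: v].

Definition highest_weight_module mu : Prop :=
  exists v, [/\ v != 0, weight_space mu v, forall i, act_e M i v = 0 &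
                forall U, submodule U -> U v -> U = setT].

Definition is_weight mu : Prop := exists2 v, v != 0 & weight_space mu v.

Definition max_weights : set (cartan_dual F l) :=
  [set mu | is_weight mu /\ ~ is_weight (mu + null_root F l)].

End Modules.

(* Main.v *)
(** Integrability of V = V(Lambda_k) makes its set of weights W-stable, and every
    weight lies in Lambda_k - Q_+, so each weight is W-conjugate to a dominant
    one.  Conversely every dominant element of Lambda_k - Q_+ is a weight: one
    descends to it from Lambda_k by subtracting simple roots, and the descent
    cannot get stuck because the level is positive.  A dominant weight of level 1
    is Lambda_j - z delta; after doubling the end coordinates the Cartan matrix
    becomes the Laplacian of a path, and this shows that Lambda_j - z delta lies
    in Lambda_k - Q_+ iff j = k mod 2, 0 <= z and j - k <= 2 z.  The maximal ones
    are those with z = max(0, (j - k) / 2), and telescoping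
    alpha_n = (Lambda_n - Lambda_(n-1)) - (Lambda_(n+1) - Lambda_n) identifies
    them with the Lambda_k + xi_(k, +-i) - (i / 2) delta. *)

Require Import Defs.
From HB Require Import structures.
From mathcomp Require Import all_boot all_order all_algebra.
From mathcomp Require Import boolp classical_sets.
From mathcomp Require Import zify ring.
Import Order.TTheory GRing.Theory Num.Theory.
Local Open Scope ring_scope.
Local Open Scope classical_set_scope.

Set Implicit Arguments.
Unset Strict Implicit.
Unset Printing Implicit Defensive.

(** * Local nilpotency and iterated commutators *)

Section LocallyNilpotent.
Variables (F : numFieldType) (V : lmodType F) (x : {linear V -> V}).

Definition locally_nilpotent_at (v : V) : Prop := exists m, iter m x v = 0.

Lemma iter_linear0 m : iter m x 0 = 0.
Proof. by elim: m => //= m ->; rewrite linear0. Qed.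

Lemma iter_linearP m a u v :
  iter m x (a *: u + v) = a *: iter m x u + iter m x v.
Proof. by elim: m => //= m ->; rewrite linearP. Qed.

Lemma locally_nilpotent0 : locally_nilpotent_at 0.
Proof. by exists 0. Qed.

Lemma locally_nilpotentP a u v : locally_nilpotent_at u ->
  locally_nilpotent_at v -> locally_nilpotent_at (a *: u + v).
Proof.
move=> [m mu] [n nv]; exists (m + n)%N.
by rewrite iter_linearP {1}addnC !iterD mu nv !iter_linear0 scaler0 addr0.
Qed.

Lemma locally_nilpotentZ a u :
  locally_nilpotent_at u -> locally_nilpotent_at (a *: u).
Proof.
by move=> u_nil; rewrite -[_ *: _]addr0; apply: locally_nilpotentP;
  last exact: locally_nilpotent0.
Qed.

Lemma locally_nilpotentD u v : locally_nilpotent_at u ->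
  locally_nilpotent_at v -> locally_nilpotent_at (u + v).
Proof. by rewrite -{2}[u]scale1r; apply: locally_nilpotentP. Qed.

(** Write [x (y v)] as [y (x v)] plus the bracket applied to [v]. The bracket term is covered by
    hypothesis, and [x v] dies one step earlier than [v], so induction on the exponent applies. *)
Lemma locally_nilpotent_bracket (y : V -> V) : y 0 = 0 ->
  (forall v, locally_nilpotent_at v -> locally_nilpotent_at (bracket x y v)) ->
  forall v, locally_nilpotent_at v -> locally_nilpotent_at (y v).
Proof.
move=> y0 xy_nil v [m]; elim: m v => [|m IHm] v /=.
  by move=> ->; rewrite y0; exact: locally_nilpotent0.
rewrite -iterS iterSr => xv_nil.
suff [n xyv]: locally_nilpotent_at (x (y v)) by exists n.+1; rewrite iterSr.
rewrite -[x (y v)](subrK (y (x v))); apply: locally_nilpotentD.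
  by apply: xy_nil; exists m.+1; rewrite iterSr.
exact: IHm.
Qed.

(** Works back from the vanishing [n]-fold bracket, one bracket at a time. This is how the Serre
    relations enter integrability. *)
Lemma locally_nilpotent_iter_bracket (y : V -> V) n : y 0 = 0 ->
  (forall v, iter n (bracket x) y v = 0) ->
  forall v, locally_nilpotent_at v -> locally_nilpotent_at (y v).
Proof.
move=> y0; elim: n y y0 => [|n IHn] y y0 xy_nil.
  by move=> v _; rewrite [y v]xy_nil; exact: locally_nilpotent0.
apply: locally_nilpotent_bracket => //.
apply: IHn => [|v]; first by rewrite /bracket y0 linear0 y0 subrr.
by rewrite -iterSr.
Qed.

End LocallyNilpotent.

(** * Strings for sl2 *)

Section SL2.
Variables (F : numFieldType) (V : lmodType F) (x y h : {linear V -> V}).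
Implicit Types v : V.
Hypothesis xyE : forall v, bracket x y v = h v.
Hypothesis hyE : forall v, bracket h y v = - 2 *: y v.

Lemma sl2_lower c v j : h v = c *: v ->
  h (iter j y v) = (c - 2 * j%:R) *: iter j y v.
Proof.
move=> hv; elim: j => [|j IHj]; first by rewrite mulr0 subr0.
rewrite iterS -[h _](subrK (y (h (iter j y v)))).
rewrite [_ - _]hyE IHj linearZ -scalerDl; congr (_ *: _).
by rewrite -natr1; ring.
Qed.

(** Commuting [x] past one [y] at a time collects the eigenvalues [c - 2 t] for [t] from 0 to [j],
    whose sum is the coefficient. *)
Lemma sl2_raise_lower c v j : x v = 0 -> h v = c *: v ->
  x (iter j.+1 y v) = (j.+1%:R * (c - j%:R)) *: iter j y v.
Proof.
move=> xv hv; elim: j => [|j IHj].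
  rewrite -[x _](subrK (y (x v))) [_ - _]xyE /= hv xv linear0 addr0 mul1r.
  by rewrite subr0.
rewrite iterS -[x _](subrK (y (x (iter j.+1 y v)))) [_ - _]xyE.
rewrite (sl2_lower _ hv) IHj linearZ -iterS -scalerDl; congr (_ *: _).
by rewrite -!natr1; ring.
Qed.

(** For [j < n] the raising coefficient is nonzero in characteristic zero, so the vanishing of one
    lowered vector would force the vanishing of the previous one. *)
Lemma sl2_lower_neq0 v n j : v != 0 -> x v = 0 -> h v = n%:R *: v ->
  (j <= n)%N -> iter j y v != 0.
Proof.
move=> v0 xv hv; elim: j => // j IHj jn; apply: contra_neq (IHj (ltnW jn)) => yv0.
have := sl2_raise_lower j xv hv; rewrite yv0 linear0 => /esym/eqP.
rewrite scaler_eq0 mulf_eq0 pnatr_eq0 subr_eq0 eqr_nat (gtn_eqF jn).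
by move/eqP.
Qed.

End SL2.

(** * Coordinates given by the coroots and the scaling element *)

Section Pairing.
Variables (F : numFieldType) (l : nat).
Implicit Types (i j : 'I_l.+1) (h : cartan F l) (mu nu : cartan_dual F l).

Definition degree : cartan F l := col_mx 0 1.

Lemma pairing_is_scalar h : scalar (pairing h).
Proof. by move=> a mu nu; rewrite /pairing mulmxDl -scalemxAl !mxE. Qed.

HB.instance Definition _ h :=
  GRing.isLinear.Build F (cartan_dual F l) F *%R (pairing h) (pairing_is_scalar h).

Lemma pairingD h mu nu : pairing h (mu + nu) = pairing h mu + pairing h nu.
Proof. exact: linearD. Qed.

Lemma pairingB h mu nu : pairing h (mu - nu) = pairing h mu - pairing h nu.
Proof. exact: linearB. Qed.

Lemma pairingZ h a mu : pairing h (a *: mu) = a * pairing h mu.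
Proof. exact: linearZ. Qed.

Lemma pairingNl h mu : pairing (- h) mu = - pairing h mu.
Proof. by rewrite /pairing mulmxN !mxE. Qed.

Lemma pairing_coroot i mu : pairing (coroot F i) mu = mu 0 (lshift 1 i).
Proof.
rewrite /pairing /coroot -{1}[mu]hsubmxK mul_row_col mulmx0 addr0.
by rewrite -colE !mxE.
Qed.

Lemma pairing_degree mu : pairing degree mu = mu 0 (rshift l.+1 0).
Proof.
by rewrite /pairing /degree -{1}[mu]hsubmxK mul_row_col mulmx0 add0r mulmx1 mxE.
Qed.

Lemma weight_eqP mu nu :
  (forall i, pairing (coroot F i) mu = pairing (coroot F i) nu) ->
  pairing degree mu = pairing degree nu -> mu = nu.
Proof.
move=> eqc eqd; apply/rowP => c; case: (split_ordP c) => i -> {c}.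
  by rewrite -!pairing_coroot.
by rewrite (ord1 i) -!pairing_degree.
Qed.

Lemma pairing_inj mu nu : (forall h, pairing h mu = pairing h nu) -> mu = nu.
Proof. by move=> eqmn; apply: weight_eqP => [i|]; exact: eqmn. Qed.

Lemma pairing_coroot_root i j :
  pairing (coroot F i) (simple_root F j) = (cartanC l i j)%:~R.
Proof. by rewrite pairing_coroot simple_root_lshift. Qed.

Lemma pairing_degree_root j : pairing degree (simple_root F j) = (j == ord0)%:R.
Proof. by rewrite pairing_degree simple_root_rshift. Qed.

Lemma pairing_coroot_fund i j :
  pairing (coroot F i) (fund_weight F j) = (i == j)%:R.
Proof. by rewrite pairing_coroot /fund_weight row_mxEl mxE eqxx. Qed.

Lemma pairing_degree_fund j : pairing degree (fund_weight F j) = 0.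
Proof. by rewrite pairing_degree /fund_weight row_mxEr mxE. Qed.

Lemma pairing_coroot_null i : (1 < l)%N ->
  pairing (coroot F i) (null_root F l) = 0.
Proof. by move=> l_gt1; rewrite null_rootE // pairing_coroot row_mxEl mxE. Qed.

Lemma pairing_degree_null : (1 < l)%N -> pairing degree (null_root F l) = 1.
Proof. by move=> l_gt1; rewrite null_rootE // pairing_degree row_mxEr mxE. Qed.

End Pairing.

(** * The Chevalley involution *)

Section Twist.
Variables (F : numFieldType) (l : nat) (V : lmodType F) (M : km_module l V).

Lemma act_hN h v : act_h M (- h) v = - act_h M h v.
Proof.
have act_h0 : act_h M 0 v = 0.
  have := act_h_linear M 1 0 0 v; rewrite !scale1r addr0 => /eqP.
  by rewrite -subr_eq subrr => /eqP <-.
by have := act_h_linear M (-1) h 0 v; rewrite act_h0 !addr0 !scaleN1r.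
Qed.

Lemma twist_h_linear a h h' v :
  act_h M (- (a *: h + h')) v = a *: act_h M (- h) v + act_h M (- h') v.
Proof. by rewrite !act_hN act_h_linear scalerN opprD. Qed.

Lemma twist_hh h h' v : bracket (act_h M (- h)) (act_h M (- h')) v = 0.
Proof. exact: act_hh. Qed.

Lemma twist_ef i j v : bracket (act_f M i) (act_e M j) v =
  if i == j then act_h M (- coroot F i) v else 0.
Proof.
rewrite -[LHS]opprK /bracket opprB -/(bracket (act_e M j) (act_f M i) v) act_ef.
by rewrite eq_sym; case: eqP => [->|_]; rewrite ?act_hN ?oppr0.
Qed.

Lemma twist_he h i v : bracket (act_h M (- h)) (act_f M i) v =
  pairing h (simple_root F i) *: act_f M i v.
Proof. by rewrite act_hf pairingNl opprK. Qed.

Lemma twist_hf h i v : bracket (act_h M (- h)) (act_e M i) v =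
  - pairing h (simple_root F i) *: act_e M i v.
Proof. by rewrite act_he pairingNl. Qed.

(* The pullback of M along the Chevalley involution; it transfers statements
   about the e_i to the f_i. *)
Definition chevalley_twist : km_module l V :=
  KMModule twist_h_linear twist_hh twist_ef twist_he twist_hf
    (act_serre_f M) (act_serre_e M).

Lemma weight_space_twist mu :
  weight_space chevalley_twist mu = weight_space M (- mu).
Proof.
apply/seteqP; split=> v vmu h; have := vmu (- h) => /=;
  by rewrite ?opprK pairingNl linearN /= ?opprK.
Qed.

Lemma is_weight_twist mu : is_weight chevalley_twist mu = is_weight M (- mu).
Proof. by rewrite /is_weight weight_space_twist. Qed.

Lemma submodule_twist U : submodule chevalley_twist U <-> submodule M U.
Proof.
split=> -[U0 Ul Ue Uf Uh]; split=> // h v Uv; last exact: Uh.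
by rewrite -[h]opprK; exact: Uh.
Qed.

End Twist.

(** * The affine Cartan matrix as a path Laplacian *)

Section Cartan.
Variables (l : nat) (l_gt1 : (1 < l)%N).
Implicit Types (i j : 'I_l.+1) (b : 'cV[int]_l.+1) (n : nat).

(* Doubling the two end coordinates of b turns the Cartan matrix into the graph
   Laplacian of the path 0 - 1 - ... - l. *)
Definition path_coord b n : int :=
  (if (n == 0%N) || (n == l) then 2 else 1) * b (inord n) 0.

(** Only the edge from [n] to [n + 1] leaves the vertices 0 to [n], so a partial column sum of the
    Laplacian is supported at the two ends of that edge. The leading factor is the doubling of the
    end coordinates. *)
Lemma cartanC_row_sum n j : (n < l)%N ->
  \sum_(0 <= i < n.+1) cartanC l (inord i) j =
  (if (j == 0%N :> nat) || (j == l :> nat) then 2 else 1)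
    * (if j == n :> nat then 1 else if j == n.+1 :> nat then -1 else 0).
Proof.
elim: n => [|n IHn] n_lt.
  rewrite big_nat1 !mxE -!val_eqE /= inordK //.
  by have := ltn_ord j; do ![case: eqP => //=]; lia.
rewrite big_nat_recr //= IHn 1?ltnW // !mxE -!val_eqE /= inordK 1?ltnW //.
by have := ltn_ord j; do ![case: eqP => //=]; lia.
Qed.

(** All comarks are 1: the sum of the simple coroots is central, and the level of a weight is the
    sum of its labels. *)
Lemma cartanC_col_sum j : \sum_(0 <= i < l.+1) cartanC l (inord i) j = 0.
Proof.
have [m lE] : exists m, l = m.+1 by exists l.-1; rewrite prednK // ltnW.
rewrite big_nat_recr //= [X in \sum_(0 <= i < X) _]lE cartanC_row_sum ?lE //.
rewrite -lE !mxE -!val_eqE /= inordK //.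
by have := ltn_ord j; do ![case: eqP => //=]; lia.
Qed.

Lemma path_coord_step b n : (n < l)%N ->
  path_coord b n.+1 =
  path_coord b n - \sum_(0 <= i < n.+1) (cartanC l *m b) (inord i) 0.
Proof.
move=> n_lt; under eq_bigr do rewrite mxE.
rewrite exchange_big /=; under eq_bigr do rewrite -mulr_suml cartanC_row_sum //.
rewrite (eq_bigr (fun j : 'I_l.+1 =>
  (if j == inord n then path_coord b n else 0)
  - (if j == inord n.+1 then path_coord b n.+1 else 0))); last first.
  move=> j _; rewrite -!val_eqE /= !inordK ?ltnS ?(ltnW n_lt) // /path_coord.
  case: (nat_of_ord j =P n) => [jn|_]; case: (nat_of_ord j =P n.+1) => [jn1|_].
  - lia.
  - by rewrite mulr1 subr0 -jn inord_val.
  - by rewrite mulrN1 mulNr sub0r -jn1 inord_val.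
  - by rewrite subrr mulr0 mul0r.
by rewrite sumrB -!big_mkcond /= !big_pred1_eq; ring.
Qed.

Lemma sum_cartan_mul b : \sum_i (cartanC l *m b) i 0 = 0.
Proof.
under eq_bigr do rewrite mxE.
rewrite exchange_big /= big1 // => j _; rewrite -mulr_suml.
rewrite [\sum_i _](_ : _ = 0) ?mul0r // -[RHS](cartanC_col_sum j) big_mkord.
by apply: eq_bigr => i _; rewrite inord_val.
Qed.

Lemma path_coord_eq0 b (j : 'I_l.+1) : path_coord b j = 0 -> b j 0 = 0.
Proof.
by rewrite /path_coord inord_val; case: ifP => _ /eqP;
  rewrite mulf_eq0 /= => /eqP.
Qed.

Lemma path_coord0 b : path_coord b 0 = 2 * b ord0 0.
Proof.
by rewrite /path_coord eqxx /=; congr (_ * b _ 0); apply: val_inj;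
  rewrite /= inordK.
Qed.

Lemma path_coord_const b n : cartanC l *m b = 0 -> (n <= l)%N ->
  path_coord b n = 2 * b ord0 0.
Proof.
move=> Ab0; elim: n => [|n IHn] n_le; first exact: path_coord0.
rewrite path_coord_step // IHn 1?ltnW // big1 ?subr0 // => i _.
by rewrite Ab0 mxE.
Qed.

(** The kernel is the line of null root coefficients (1, 2, ..., 2, 1), on which the coordinate at 0
    is faithful. *)
Lemma cartan_kernel b : cartanC l *m b = 0 -> b ord0 0 = 0 -> b = 0.
Proof.
move=> Ab0 b0; apply/colP => j; rewrite mxE; apply: path_coord_eq0.
by rewrite path_coord_const ?leq_ord // b0 mulr0.
Qed.

End Cartan.

(** * Integral combinations of simple roots *)

Section RootCombinations.
Variables (F : numFieldType) (l : nat).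
Implicit Types (i j : 'I_l.+1) (b : 'cV[int]_l.+1).

Definition root_comb b : cartan_dual F l :=
  \sum_i (b i 0)%:~R *: simple_root F i.

Lemma root_combD b c : root_comb (b + c) = root_comb b + root_comb c.
Proof.
rewrite /root_comb -big_split; apply: eq_bigr => i _ /=.
by rewrite mxE intrD scalerDl.
Qed.

Lemma root_combN b : root_comb (- b) = - root_comb b.
Proof.
rewrite /root_comb -sumrN; apply: eq_bigr => i _ /=.
by rewrite mxE rmorphN scaleNr.
Qed.

Lemma root_comb0 : root_comb 0 = 0.
Proof. by rewrite /root_comb big1 // => i _; rewrite mxE scale0r. Qed.

Lemma root_comb_delta i n :
  root_comb (n *: delta_mx i 0) = n%:~R *: simple_root F i.
Proof.
rewrite /root_comb (bigD1 i) //= big1 => [|j ji].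
  by rewrite !mxE !eqxx mulr1 addr0.
by rewrite !mxE (negPf ji) mulr0 scale0r.
Qed.

Lemma pairing_coroot_comb i b :
  pairing (coroot F i) (root_comb b) = ((cartanC l *m b) i 0)%:~R.
Proof.
rewrite /root_comb linear_sum mxE rmorph_sum; apply: eq_bigr => j _ /=.
by rewrite linearZ /= pairing_coroot_root intrM mulrC.
Qed.

Lemma pairing_degree_comb b : pairing (degree F l) (root_comb b) = (b ord0 0)%:~R.
Proof.
rewrite /root_comb linear_sum (bigD1 ord0) //= big1 => [|j /negPf j0].
  by rewrite linearZ /= pairing_degree_root eqxx mulr1 addr0.
by rewrite linearZ /= pairing_degree_root j0 mulr0.
Qed.

(** The coroots alone do not see the null root; the scaling element reads off the coefficient of
    [simple_root ord0] and so settles the remaining kernel. *)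
Lemma root_comb_inj : (1 < l)%N -> injective root_comb.
Proof.
move=> l_gt1 b c bc.
suff : b - c = 0 by move/eqP; rewrite subr_eq0 => /eqP.
have bc0 : root_comb (b - c) = 0 by rewrite root_combD root_combN bc subrr.
apply: cartan_kernel => //.
  apply/colP => i; rewrite [RHS]mxE; apply: (intr_inj (R := F)).
  by rewrite -pairing_coroot_comb bc0 linear0.
by apply: (intr_inj (R := F)); rewrite -pairing_degree_comb bc0 linear0.
Qed.

End RootCombinations.

(** * Weight vectors and independence of weight spaces *)

Section WeightVectors.
Variables (F : numFieldType) (l : nat) (V : lmodType F) (M : km_module l V).
Implicit Types (i j : 'I_l.+1) (mu nu : cartan_dual F l) (u v : V).

Lemma weight_spaceZ mu a u : weight_space M mu u -> weight_space M mu (a *: u).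
Proof. by move=> umu h; rewrite linearZ /= umu !scalerA mulrC. Qed.

Lemma weight_space_f mu i v :
  weight_space M mu v -> weight_space M (mu - simple_root F i) (act_f M i v).
Proof.
move=> vmu h; rewrite -[LHS](subrK (act_f M i (act_h M h v))).
rewrite [_ - _]act_hf vmu linearZ /= -scalerDl linearB /=; congr (_ *: _).
by rewrite addrC.
Qed.

Lemma weight_space_e mu i v :
  weight_space M mu v -> weight_space M (mu + simple_root F i) (act_e M i v).
Proof.
move=> vmu h; rewrite -[LHS](subrK (act_e M i (act_h M h v))).
rewrite [_ - _]act_he vmu linearZ /= -scalerDl linearD /=; congr (_ *: _).
by rewrite addrC.
Qed.

Lemma weight_space_iter_f mu i v n : weight_space M mu v ->
  weight_space M (mu - n%:R *: simple_root F i) (iter n (act_f M i) v).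
Proof.
move=> vmu; elim: n => [|n IHn]; first by rewrite scale0r subr0.
rewrite -natr1 scalerDl scale1r opprD addrA; exact: weight_space_f.
Qed.

Lemma weight_space_iter_e mu i v n : weight_space M mu v ->
  weight_space M (mu + n%:R *: simple_root F i) (iter n (act_e M i) v).
Proof.
move=> vmu; elim: n => [|n IHn]; first by rewrite scale0r addr0.
rewrite -natr1 scalerDl scale1r addrA; exact: weight_space_e.
Qed.

Inductive weight_sum (P : set (cartan_dual F l)) : V -> Prop :=
| weight_sum0 : weight_sum P 0
| weight_sumD mu u v : P mu -> weight_space M mu u -> weight_sum P v ->
    weight_sum P (u + v).

Lemma weight_sum_add P u v :
  weight_sum P u -> weight_sum P v -> weight_sum P (u + v).
Proof.
move=> + vP; elim=> [|mu {}u w Pmu umu _ IHw]; first by rewrite add0r.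
by rewrite -addrA; exact: weight_sumD Pmu umu IHw.
Qed.

Lemma weight_sumZ P a u : weight_sum P u -> weight_sum P (a *: u).
Proof.
elim=> [|mu {}u w Pmu umu _ IHw]; first by rewrite scaler0; exact: weight_sum0.
by rewrite scalerDr; apply: weight_sumD Pmu _ IHw; exact: weight_spaceZ.
Qed.

Lemma weight_sum1 (P : set _) mu u : P mu -> weight_space M mu u -> weight_sum P u.
Proof.
move=> Pmu umu; rewrite -[u]addr0; apply: weight_sumD Pmu umu _.
exact: weight_sum0.
Qed.

(* T is a product of factors [act_h M h - nu h], one for each summand. *)
Lemma weight_sum_annihilator P mu u : ~ P mu -> weight_sum P u ->
  exists (T : V -> V) (c : F),
    [/\ c != 0, forall v w, T (v + w) = T v + T w,
        forall nu v, weight_space M nu v -> weight_space M nu (T v),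
        T u = 0 & forall v, weight_space M mu v -> T v = c *: v].
Proof.
move=> Pmu; elim=> [|nu {}u w Pnu unu _ [T [c [c0 Tadd Twt Tw Tmu]]]].
  by exists id, 1; split=> // [|v _]; rewrite ?oner_neq0 ?scale1r.
have [h hmn] : exists h, pairing h mu != pairing h nu.
  apply: contrapT => /forallNP eqmn; apply: Pmu.
  rewrite (_ : mu = nu) //; apply: pairing_inj => h.
  by apply/eqP/negPn/negP/eqmn.
exists (fun v => act_h M h (T v) - pairing h nu *: T v).
exists ((pairing h mu - pairing h nu) * c).
split=> [|v v'|nu' v vnu'||v vmu].
- by rewrite mulf_neq0 // subr_eq0.
- by rewrite Tadd linearD scalerDr opprD addrACA.
- rewrite (Twt _ _ vnu') -scalerBl; apply: weight_spaceZ; exact: Twt.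
- by rewrite Tadd Tw addr0 (Twt _ _ unu) subrr.
- by rewrite (Twt _ _ vmu) Tmu // -scalerBl scalerA.
Qed.

(** The annihilator sends [u] both to 0 and to a nonzero multiple of [u]. *)
Lemma weight_sum_eq0 P mu u :
  ~ P mu -> weight_sum P u -> weight_space M mu u -> u = 0.
Proof.
move=> Pmu Pu umu; have [T [c [c0 _ _ Tu Tmu]]] := weight_sum_annihilator Pmu Pu.
by apply/eqP; have := Tmu u umu; rewrite Tu => /esym/eqP;
  rewrite scaler_eq0 (negPf c0).
Qed.

End WeightVectors.

(** * The submodule generated by a singular vector *)

Section LowerSpan.
Variables (F : numFieldType) (l : nat) (V : lmodType F) (M : km_module l V).
Implicit Types (i j : 'I_l.+1) (mu nu : cartan_dual F l) (u v w : V).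

Inductive lower_span w : set V :=
| lower_span_gen : lower_span w w
| lower_span_f i u : lower_span w u -> lower_span w (act_f M i u)
| lower_spanP a u v :
    lower_span w u -> lower_span w v -> lower_span w (a *: u + v).

Lemma lower_span0 w : lower_span w 0.
Proof.
rewrite -[0](addNr w) -scaleN1r; apply: lower_spanP; exact: lower_span_gen.
Qed.

Lemma lower_spanD w u v :
  lower_span w u -> lower_span w v -> lower_span w (u + v).
Proof. by rewrite -{2}[u]scale1r; exact: lower_spanP. Qed.

Lemma lower_spanZ w a u : lower_span w u -> lower_span w (a *: u).
Proof.
by move=> wu; rewrite -[_ *: _]addr0; apply: lower_spanP (lower_span0 w).
Qed.

(** Moving [e_i] to the right past the [f_j] leaves only Cartan terms, since [e_i] kills [w].
    Stability under the Cartan subalgebra is therefore proved first. *)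
Lemma submodule_lower_span mu w : weight_space M mu w ->
  (forall i, act_e M i w = 0) -> submodule M (lower_span w).
Proof.
move=> wmu ew.
have span_h h u : lower_span w u -> lower_span w (act_h M h u).
  elim=> [|i {}u wu IHu|a {}u v _ IHu _ IHv].
  - by rewrite wmu; apply/lower_spanZ/lower_span_gen.
  - rewrite -[act_h _ _ _](subrK (act_f M i (act_h M h u))) [_ - _]act_hf.
    by apply: lower_spanP; exact: lower_span_f.
  - by rewrite linearP; exact: lower_spanP.
split=> // [|a u v|i u|i u]; [exact: lower_span0 | exact: lower_spanP | |
  exact: lower_span_f].
elim=> [|j {}u wu IHu|a {}u v _ IHu _ IHv].
- by rewrite ew; exact: lower_span0.
- rewrite -[act_e _ _ _](subrK (act_f M j (act_e M i u))) [_ - _]act_ef.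
  apply: lower_spanD; last exact: lower_span_f.
  by case: eqP => _; [exact: span_h | exact: lower_span0].
- by rewrite linearP; exact: lower_spanP.
Qed.

Definition root_cone mu : set (cartan_dual F l) :=
  [set nu | exists2 b : 'cV[int]_l.+1,
     forall i, 0 <= b i 0 & nu = mu - root_comb F b].

Lemma root_cone_sub mu nu i :
  root_cone mu nu -> root_cone mu (nu - simple_root F i).
Proof.
move=> [b b0 ->]; exists (b + 1 *: delta_mx i 0) => [j|].
  by rewrite !mxE addr_ge0 // mul1r.
by rewrite root_combD root_comb_delta scale1r opprD addrA.
Qed.

Lemma lower_span_weight_sum mu w u : weight_space M mu w -> lower_span w u ->
  weight_sum M (root_cone mu) u.
Proof.
move=> wmu; elim=> [|i {}u _ IHu|a {}u v _ IHu _ IHv].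
- apply: weight_sum1 wmu; exists 0 => [i|]; first by rewrite mxE.
  by rewrite root_comb0 subr0.
- elim: IHu => [|nu {}u v nuP unu _ IHv].
    by rewrite linear0; exact: weight_sum0.
  rewrite linearD; apply: weight_sumD IHv; last exact: weight_space_f unu.
  exact: root_cone_sub.
- by apply: weight_sum_add => //; exact: weight_sumZ.
Qed.

End LowerSpan.

(** * Local nilpotency of the raising operators and root strings *)

Section Integrable.
Variables (F : numFieldType) (l : nat) (V : lmodType F) (M : km_module l V).
Implicit Types (i j : 'I_l.+1) (mu nu : cartan_dual F l) (u v w : V).

(** Bracketing [e_i] with [h] gives a multiple of [e_i], with [f_j] a Cartan element or 0, and with
    [e_j] repeatedly gives 0 by Serre. Local nilpotency thus need only be checked on a generator. *)
Lemma submodule_locally_nilpotent i :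
  submodule M (locally_nilpotent_at (act_e M i)).
Proof.
have nil_h h v : locally_nilpotent_at (act_e M i) v ->
    locally_nilpotent_at (act_e M i) (act_h M h v).
  apply: locally_nilpotent_bracket => [|{}v v_nil]; first exact: linear0.
  rewrite -[bracket _ _ _]opprK /bracket opprB [_ - _]act_he -scaleNr.
  apply: locally_nilpotentZ; case: v_nil => m mv; exists m.
  by rewrite -iterSr iterS mv linear0.
split=> // [|a u v|j v|j v].
- exact: locally_nilpotent0.
- exact: locally_nilpotentP.
- have [<- [m mv]|ij] := eqVneq i j.
    by exists m; rewrite -iterSr iterS mv linear0.
  apply: (locally_nilpotent_iter_bracket (n := `|1 - cartanC l i j|%N)).
    exact: linear0.
  by move=> {}v; exact: act_serre_e.
- apply: locally_nilpotent_bracket => [|{}v v_nil]; first exact: linear0.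
  by rewrite act_ef; case: eqP => _; [exact: nil_h | exact: locally_nilpotent0].
Qed.

Definition e_integrable : Prop :=
  forall i v, locally_nilpotent_at (act_e M i) v.

(** A vector of weight [mu] is raised to the top of its string and then lowered past [mu]; sl2
    theory keeps the result nonzero. *)
Lemma is_weight_string i mu (n j : nat) : e_integrable -> is_weight M mu ->
  pairing (coroot F i) mu = n%:R -> (j <= n)%N ->
  is_weight M (mu - j%:R *: simple_root F i).
Proof.
move=> e_int [v v0 vmu] mun jn.
have /cid [m0 /eqP m0v] := e_int i v.
have [p /eqP pv p_min] :=
  ex_minnP (ex_intro (fun m => iter m (act_e M i) v == 0) m0 m0v).
(* As [v] is nonzero, its least killing exponent has the form [p + 1]. Then [w] is killed by [e_i]
   and has label [n + 2 p], which bounds the [p + j] lowerings because [j <= n]. *)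
case: p pv p_min => [/= v_eq0|p pv p_min]; first by rewrite v_eq0 eqxx in v0.
set w := iter p (act_e M i) v.
have w0 : w != 0 by apply/negP => /p_min; rewrite ltnn.
have wmu := weight_space_iter_e i p vmu.
exists (iter (p + j) (act_f M i) w); last first.
  have := weight_space_iter_f i (p + j) wmu.
  by rewrite natrD scalerDl opprD addrA addrK.
apply: (@sl2_lower_neq0 _ _ (act_e M i) (act_f M i)
  (act_h M (coroot F i)) _ _ _ (n + p.*2)) => //.
- by move=> u; rewrite act_ef eqxx.
- by move=> u; rewrite act_hf pairing_coroot_root mxE eqxx.
- rewrite wmu linearD linearZ /= mun pairing_coroot_root mxE eqxx.
  by congr (_ *: _); rewrite natrD -muln2 natrM.
- by lia.
Qed.

End Integrable.

(** * Integrability and Weyl invariance of the weights *)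

Section HighestWeight.
Variables (F : numFieldType) (l : nat) (l_gt1 : (1 < l)%N).
Variables (V : lmodType F) (M : km_module l V) (Lam : cartan_dual F l).
Implicit Types (i j : 'I_l.+1) (mu nu : cartan_dual F l).
Hypothesis Mirr : irreducible_module M.
Hypothesis Mhw : highest_weight_module M Lam.
Hypothesis Lam_dom : forall i, exists n : nat, pairing (coroot F i) Lam = n%:R.

(** The module is the lower span of a highest weight vector, hence a sum of weight vectors from the
    cone; independence excludes any other weight. *)
Lemma is_weight_cone mu : is_weight M mu -> root_cone Lam mu.
Proof.
have [w [w0 wLam ew genw]] := Mhw; move=> [v v0 vmu].
apply: contrapT => muP; move/eqP: v0; apply.
apply: (weight_sum_eq0 muP _ vmu); apply: (lower_span_weight_sum wLam).
by rewrite (genw (lower_span M w)) //;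
  [exact: submodule_lower_span wLam ew | exact: lower_span_gen].
Qed.

Lemma highest_is_weight : is_weight M Lam.
Proof. by have [w [w0 wLam _ _]] := Mhw; exists w. Qed.

Lemma e_integrable_highest : e_integrable M.
Proof.
have [w [w0 wLam ew genw]] := Mhw; move=> i v.
have nilT := genw _ (submodule_locally_nilpotent M i).
have : [set: V] v by [].
by rewrite -nilT //; exists 1%N; exact: ew.
Qed.

(* Otherwise [f_i ^ (n + 1) w] would be a singular vector, generating a proper
   submodule. *)
Lemma iter_f_highest i n w : weight_space M Lam w ->
  (forall i, act_e M i w = 0) -> w != 0 ->
  pairing (coroot F i) Lam = n%:R -> iter n.+1 (act_f M i) w = 0.
Proof.
move=> wLam ew w0 Lamn; apply/eqP/negPn/negP; set u := iter _ _ _ => u0.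
have uLam := weight_space_iter_f i n.+1 wLam; rewrite -/u in uLam.
(* For [j = i] the coefficient contains the factor [n - n]; for other [j] the operators [e_j] and
   [f_i] commute. *)
have eu j : act_e M j u = 0.
  have [->|ji] := eqVneq j i.
    rewrite /u (@sl2_raise_lower _ _ _ _ (act_h M (coroot F i)) _ _ n%:R) //.
    - by rewrite subrr mulr0 scale0r.
    - by move=> v; rewrite act_ef eqxx.
    - by move=> v; rewrite act_hf pairing_coroot_root mxE eqxx.
    - by rewrite wLam Lamn.
  rewrite /u; elim: n.+1 => //= m IHm.
  rewrite -[LHS](subrK (act_f M i (act_e M j (iter m (act_f M i) w)))).
  by rewrite [_ - _]act_ef (negPf ji) IHm linear0 addr0.
have [E|E] := Mirr.2 _ (submodule_lower_span uLam eu).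
  by have := lower_span_gen M u; rewrite E => /= u_eq0; rewrite u_eq0 eqxx in u0.
(* If [u] generated everything, [Lam] would lie in the cone below the weight of [u], and comparing
   coefficients at [i] would give [b i 0 = -(n + 1)]. *)
have : weight_sum M (root_cone (Lam - n.+1%:R *: simple_root F i)) w.
  by apply: lower_span_weight_sum uLam _; rewrite E.
move=> /weight_sum_eq0 -/(_ Lam) w_eq0; move/eqP: w0; apply; apply: w_eq0 => //.
move=> [b b0 /eqP]; rewrite -subr_eq0 !opprD !opprK !addrA subrr add0r.
rewrite -[_%:R *: _](root_comb_delta F i n.+1) -root_combD -(root_comb0 F l).
move=> /eqP/(root_comb_inj l_gt1)/colP/(_ i).
by rewrite !mxE !eqxx /= mulr1; have := b0 i; lia.
Qed.

(** In the twist the raising operators are the [f_i], so this is the other half of integrability. *)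
Lemma e_integrable_twist : e_integrable (chevalley_twist M).
Proof.
have [w [w0 wLam ew genw]] := Mhw; move=> i v.
have /submodule_twist nil_sub := submodule_locally_nilpotent (chevalley_twist M) i.
have : [set: V] v by [].
rewrite -(genw _ nil_sub) //; have [n Lamn] := Lam_dom i; exists n.+1.
exact: iter_f_highest wLam ew w0 Lamn.
Qed.

(** A nonnegative label is a descent along the root string of [mu]; a negative one is the same
    descent for [- mu] in the twist. *)
Lemma is_weight_reflection i mu : is_weight M mu -> is_weight M (reflection i mu).
Proof.
move=> mu_wt; have [b b0 muE] := is_weight_cone mu_wt.
have [n Lamn] := Lam_dom i.
have : pairing (coroot F i) mu = (n%:Z - (cartanC l *m b) i 0)%:~R.
  by rewrite muE linearB /= Lamn pairing_coroot_comb intrB.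
rewrite /reflection; case: (_ - _) => m mun; rewrite mun.
  rewrite -pmulrn in mun *.
  exact: is_weight_string e_integrable_highest mu_wt mun (leqnn m).
have := is_weight_string (i := i) (mu := - mu) (n := m.+1) (j := m.+1)
  e_integrable_twist.
rewrite NegzE mulrNz scaleNr opprK -pmulrn in mun *.
rewrite !is_weight_twist opprD !opprK => /(_ mu_wt); apply=> //.
by rewrite linearN /= mun opprK.
Qed.
End HighestWeight.

(** * Level one labels and the equation [cartanC l *m b = delta_mx k 0 - delta_mx j 0] *)

Lemma nonneg_sum1 n (x : 'I_n -> int) : (forall i, 0 <= x i) ->
  \sum_i x i = 1 -> exists j, forall i, x i = (i == j)%:R.
Proof.
move=> x0 x1.
have [j xj] : exists j, 0 < x j.
  apply: contrapT => /forallNP xN; move: x1; rewrite big1 // => i _.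
  by have := x0 i; have /negP := xN i; lia.
exists j.
have xj1 : \sum_(i | i != j) x i = 0.
  apply: le_anti; rewrite sumr_ge0 // andbT -(lerD2l (x j)) addr0.
  by move: x1; rewrite (bigD1 j) //= => ->; rewrite -gtz0_ge1.
move=> i; have [->|ij] := eqVneq i j.
  by move: x1; rewrite (bigD1 j) //= xj1 addr0.
exact: (psumr_eq0P (fun i _ => x0 i) xj1).
Qed.

Section LevelOne.
Variables (l : nat) (l_gt1 : (1 < l)%N).
Implicit Types (i j k : 'I_l.+1) (b : 'cV[int]_l.+1).

Lemma sum_nat_inord_delta k n : (n <= l)%N ->
  \sum_(0 <= i < n.+1) (delta_mx k 0 : 'cV[int]_l.+1) (inord i) 0 = (k <= n)%N.
Proof.
elim: n => [|n IHn] n_le.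
  by rewrite big_nat1 mxE -val_eqE /= inordK // andbT; case: (nat_of_ord k).
rewrite big_nat_recr //= (IHn (ltnW n_le)) mxE -val_eqE /= inordK // andbT.
by case: (ltngtP k n.+1); lia.
Qed.

Lemma sum_ord_inord (G : 'I_l.+1 -> int) :
  \sum_i G i = \sum_(0 <= i < l.+1) G (inord i).
Proof. by rewrite big_mkord; apply: eq_bigr => i _; rewrite inord_val. Qed.

Lemma sum_nat_inord_deltaB k j n : (n <= l)%N ->
  \sum_(0 <= i < n.+1) (delta_mx k 0 - delta_mx j 0 : 'cV[int]_l.+1) (inord i) 0 =
  (k <= n)%N%:Z - (j <= n)%N%:Z.
Proof.
move=> n_le; rewrite -!sum_nat_inord_delta // -sumrB.
by apply: eq_bigr => i _; rewrite mxE [X in _ + X]mxE.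
Qed.

Lemma eq_partial_sums (x y : 'cV[int]_l.+1) :
  (forall n, (n <= l)%N -> \sum_(0 <= i < n.+1) x (inord i) 0 =
                           \sum_(0 <= i < n.+1) y (inord i) 0) -> x = y.
Proof.
move=> eqxy; apply/colP => i; rewrite -[i]inord_val.
have := eqxy i; rewrite -ltnS => /(_ (ltn_ord i)).
case: (nat_of_ord i) (ltn_ord i) => [|n] n_lt.
  by rewrite !big_nat1.
rewrite !(big_nat_recr n.+1) //= eqxy; last by rewrite ltnW.
exact: addrI.
Qed.

Lemma path_coord_max b : path_coord b l = 2 * b ord_max 0.
Proof.
by rewrite /path_coord eqxx orbT /=; congr (_ * b _ 0); apply: val_inj;
  rewrite /= inordK.
Qed.

(** Summing the right-hand side twice gives a piecewise linear function with kinks at [k] and [j];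
    the truncated subtractions are its positive parts. *)
Lemma path_coord_delta b k j n : cartanC l *m b = delta_mx k 0 - delta_mx j 0 ->
  (n <= l)%N -> path_coord b n = 2 * b ord0 0 - (n - k)%N%:Z + (n - j)%N%:Z.
Proof.
move=> Ab; elim: n => [|n IHn] n_le.
  by rewrite path_coord0 !sub0n subr0 addr0.
rewrite path_coord_step // (IHn (ltnW n_le)) Ab.
by rewrite sum_nat_inord_deltaB ?(ltnW n_le) //; lia.
Qed.

(** The solution in [path_coord_delta] with value [z] at 0, halved at the ends. The last entry is
    [z + (k - j) / 2], which [uphalf] expresses for [k] and [j] of equal parity; the truncated
    subtractions are exact once [j <= k + 2 z]. *)
Definition null_shift_coef k j (z : nat) : 'cV[int]_l.+1 :=
  \col_n (if n == ord0 then z%:Z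
          else if n == ord_max then (z + uphalf k - uphalf j)%N%:Z
          else (z.*2 + (n - j) - (n - k))%N%:Z).

Lemma path_coord_null_shift k j z n : odd k = odd j -> (j <= k + z.*2)%N ->
  (n <= l)%N ->
  path_coord (null_shift_coef k j z) n = z.*2%:Z - (n - k)%N%:Z + (n - j)%N%:Z.
Proof.
move=> kj zP n_le; rewrite /path_coord mxE -!val_eqE /= inordK //.
have := ltn_ord k; have := ltn_ord j; have := odd_double_half k.
have := odd_double_half j; rewrite !uphalf_half kj.
by case: eqP => n0 /=; [|case: eqP => nl /=]; lia.
Qed.

Lemma cartan_null_shift k j z : odd k = odd j -> (j <= k + z.*2)%N ->
  cartanC l *m null_shift_coef k j z = delta_mx k 0 - delta_mx j 0.
Proof.
move=> kj zP; apply: eq_partial_sums => n n_le.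
rewrite sum_nat_inord_deltaB //.
have [n_lt|] := ltnP n l; last first.
  move=> l_le; have -> : n = l by apply/eqP; rewrite eqn_leq n_le.
  have := sum_cartan_mul l_gt1 (null_shift_coef k j z).
  by rewrite sum_ord_inord => ->; rewrite !leq_ord subrr.
(* Subtracting both sides from the path coordinate at [n] turns the partial sum into the path
   coordinate at [n + 1]. *)
apply: (can_inj (subKr (path_coord (null_shift_coef k j z) n))).
by rewrite -path_coord_step // !path_coord_null_shift //; lia.
Qed.

Lemma null_shift_coef_ge0 k j z n : 0 <= null_shift_coef k j z n 0.
Proof. by rewrite mxE; do 2?case: ifP. Qed.

Lemma cartanC_offdiag i j : i != j -> cartanC l i j <= 0.
Proof. by rewrite mxE => /negPf ->; do ?case: ifP. Qed.

End LevelOne.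

(** * Dominant weights of the fundamental module *)

Section FundamentalModule.
Variables (F : numFieldType) (l : nat) (l_gt1 : (1 < l)%N) (k : 'I_l.+1).
Variables (V : lmodType F) (M : km_module l V).
Hypothesis Mirr : irreducible_module M.
Hypothesis Mhw : highest_weight_module M (fund_weight F k).
Implicit Types (i j : 'I_l.+1) (mu nu lam : cartan_dual F l) (a b : 'cV[int]_l.+1).

Definition label b i : int := (i == k)%:R - (cartanC l *m b) i 0.

Lemma fund_dominant i :
  exists n : nat, pairing (coroot F i) (fund_weight F k) = n%:R.
Proof. by exists (i == k); rewrite pairing_coroot_fund. Qed.

Lemma pairing_label b i :
  pairing (coroot F i) (fund_weight F k - root_comb F b) = (label b i)%:~R.
Proof.
by rewrite linearB /= pairing_coroot_fund pairing_coroot_comb intrB mulrz_nat.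
Qed.

(** Subtracting roots preserves the level. *)
Lemma sum_label b : \sum_i label b i = 1.
Proof.
rewrite sumrB sum_cartan_mul // subr0 (bigD1 k) //= eqxx big1 ?addr0 //.
by move=> i /negPf ->.
Qed.

(* If no simple root can be subtracted from Lambda_k - b on the way to
   Lambda_k - a, then u = a - b satisfies A u <= 0; as the rows of A sum to 0
   this forces A u = 0, so u is a positive multiple of delta, and every label of
   Lambda_k - b is nonpositive although their sum, the level, is 1. *)
Lemma exists_lowering (a b : 'cV[int]_l.+1) : a != b ->
  (forall i, b i 0 <= a i 0) -> (forall i, 0 <= label a i) ->
  exists i, b i 0 < a i 0 /\ 0 < label b i.
Proof.
move=> ab b_le a_dom; apply: contrapT => /forallNP noi.
have lab i : b i 0 < a i 0 -> label b i <= 0.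
  by move=> bi; have := noi i; case: (ltrP 0 (label b i)) => // ? [].
pose u := a - b.
have Au i : (cartanC l *m u) i 0 = label b i - label a i.
  by rewrite /u mulmxBr mxE [X in _ + X]mxE /label; ring.
(* Where [b] is below [a], the label of [b] is nonpositive and that of [a] nonnegative; elsewhere
   [u] vanishes and only off-diagonal entries contribute. *)
have Au_le0 i : (cartanC l *m u) i 0 <= 0.
  have [bi|ai] := ltrP (b i 0) (a i 0).
    by rewrite Au subr_le0; apply: le_trans (lab _ bi) (a_dom i).
  rewrite mxE; apply: sumr_le0 => j _; have [<-|ij] := eqVneq i j.
    by rewrite !mxE (le_anti (introT andP (conj (b_le i) ai))) subrr mulr0.
  by rewrite mulr_le0_ge0 ?cartanC_offdiag // !mxE subr_ge0.
have Au0 : cartanC l *m u = 0.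
  apply/colP => i; rewrite [RHS]mxE; apply/eqP; rewrite -oppr_eq0; apply/eqP.
  apply: (psumr_eq0P (P := predT) (F := fun i => - (cartanC l *m u) i 0)) => //.
    by move=> j _; rewrite oppr_ge0.
  by rewrite sumrN sum_cartan_mul // oppr0.
have u_neq0 : u ord0 0 != 0.
  by apply: contra_neq ab => u0;
    apply/eqP; rewrite -subr_eq0; apply/eqP/cartan_kernel.
have := sum_label b; suff : \sum_i label b i <= 0 by lia.
(* A zero of [u] would force the constant [path_coord u] to vanish, so [b] is strictly below [a]
   everywhere. *)
apply: sumr_le0 => i _; apply: lab; rewrite lt_neqAle b_le andbT.
apply: contra_neq u_neq0 => bai.
have ui0 : u i 0 = 0 by rewrite !mxE bai subrr.
have : path_coord u i = 0 by rewrite /path_coord inord_val ui0 mulr0.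
by rewrite path_coord_const ?leq_ord // => /eqP; rewrite mulf_eq0 => /eqP.
Qed.

(** Induction on the height of [a - b]: at a vertex with positive label the root string allows one
    more subtraction. *)
Lemma dominant_is_weight a : (forall i, 0 <= a i 0) ->
  (forall i, 0 <= label a i) -> is_weight M (fund_weight F k - root_comb F a).
Proof.
move=> a0 a_dom.
suff wt n b : (forall i, b i 0 <= a i 0) -> \sum_i (a i 0 - b i 0) <= n%:Z ->
    is_weight M (fund_weight F k - root_comb F b) ->
    is_weight M (fund_weight F k - root_comb F a).
  apply: (wt `|(\sum_i a i 0)%R|%N 0) => [i||]; first by rewrite mxE.
    by under eq_bigr do rewrite mxE subr0; exact: ler_norm.
  by rewrite root_comb0 subr0; exact: highest_is_weight Mhw.
elim: n b => [|n IHn] b b_le ab_n b_wt.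
  suff -> : a = b by [].
  apply/colP => i; apply/eqP; rewrite -subr_eq0; apply/eqP.
  apply: (psumr_eq0P (P := predT) (F := fun i => a i 0 - b i 0)) => //.
    by move=> j _; rewrite subr_ge0.
  apply: le_anti; rewrite ab_n sumr_ge0 // => j _.
  by rewrite subr_ge0.
have [->//|ab] := eqVneq a b.
have [i [bi lab]] := exists_lowering ab b_le a_dom.
apply: (IHn (b + 1 *: delta_mx i 0)) => [j||].
- rewrite !mxE andbT mul1r; case: eqP => [->|_]; last by rewrite addr0.
  by move: bi; rewrite lezD1.
- under eq_bigr do rewrite !mxE andbT mul1r opprD addrA.
  rewrite sumrB [X in _ - X](bigD1 i) //= eqxx /=.
  rewrite [X in _ - (_ + X)]big1; last first.
    by move=> j /negPf ->.
  by rewrite addr0 lerBlDr addrC -intS.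
- rewrite root_combD root_comb_delta opprD addrA.
  have := pairing_label b i; have -> : label b i = `|label b i|%N by lia.
  rewrite -pmulrn => lab_n.
  apply: (is_weight_string (j := 1) (e_integrable_highest Mhw) b_wt lab_n).
  by lia.
Qed.

Lemma fund_sub_comb b j (z : nat) : b ord0 0 = z%:Z ->
  cartanC l *m b = delta_mx k 0 - delta_mx j 0 ->
  fund_weight F k - root_comb F b = fund_weight F j - z%:R *: null_root F l.
Proof.
move=> b0 Ab; apply: weight_eqP => [i|]; rewrite !linearB !linearZ /=.
  rewrite !pairing_coroot_fund pairing_coroot_comb pairing_coroot_null //.
  by rewrite Ab !mxE !andbT intrB !mulrz_nat; ring.
by rewrite !pairing_degree_fund pairing_degree_comb pairing_degree_null // b0 mulr1.
Qed.

Lemma dominant_weightP lam :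
  (is_weight M lam /\ forall i, 0 <= pairing (coroot F i) lam) <->
  exists j (z : nat), [/\ odd k = odd j, (j <= k + z.*2)%N &
    lam = fund_weight F j - z%:R *: null_root F l].
Proof.
split=> [[lam_wt lam_dom]|[j [z [kj zP lamE]]]].
  have [b b0 lamE] := is_weight_cone Mhw lam_wt.
  have b_dom i : 0 <= label b i.
    by rewrite -(ler0z F) -pairing_label -lamE; exact: lam_dom.
  have [j labE] := nonneg_sum1 b_dom (sum_label b).
  have Ab : cartanC l *m b = delta_mx k 0 - delta_mx j 0.
    by apply/colP => i; rewrite !mxE !andbT -labE /label mxE; ring.
  exists j, `|(b ord0 0)%R|%N.
  (* At the last vertex this reads [2 b_l = 2 b_0 + k - j]; parity and [b_l >= 0] are the two
     conditions on [j]. *)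
  have := path_coord_delta l_gt1 Ab (leqnn l); rewrite path_coord_max.
  have := b0 ord0; have := b0 ord_max; have := ltn_ord k; have := ltn_ord j.
  move=> jl kl bl b00 bE; split; [lia|lia|].
  by rewrite lamE; apply: fund_sub_comb => //; lia.
have Ab := cartan_null_shift l_gt1 kj zP.
have b0 : null_shift_coef k j z ord0 0 = z%:Z by rewrite mxE eqxx.
have lab i : label (null_shift_coef k j z) i = (i == j)%:R.
  by rewrite /label Ab !mxE !andbT; ring.
rewrite lamE -(fund_sub_comb b0 Ab); split=> [|i]; last first.
  by rewrite pairing_label lab ler0z; case: eqP.
apply: dominant_is_weight => i; first exact: null_shift_coef_ge0.
by rewrite lab; case: eqP.
Qed.

End FundamentalModule.

(** * Reflections and the invariance of the null root *)

Section Reflections.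
Variables (F : numFieldType) (l : nat) (l_gt1 : (1 < l)%N).
Implicit Types (i j : 'I_l.+1) (mu nu : cartan_dual F l).

Lemma reflectionK i : involutive (reflection (F := F) i).
Proof.
move=> mu; rewrite /reflection pairingB pairingZ pairing_coroot_root mxE eqxx.
rewrite -addrA -opprD -scalerDl [X in X *: _](_ : _ = 0); last by ring.
by rewrite scale0r subr0.
Qed.

Lemma reflection_sub_null i mu (m : F) :
  reflection i (mu - m *: null_root F l) = reflection i mu - m *: null_root F l.
Proof.
rewrite /reflection pairingB pairingZ pairing_coroot_null // mulr0 subr0.
by rewrite addrAC.
Qed.

Lemma weyl_sub_null w mu (m : F) : weyl_group F l w ->
  w (mu - m *: null_root F l) = w mu - m *: null_root F l.
Proof.
by elim=> [|i {}w _ IHw] //=; rewrite IHw reflection_sub_null.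
Qed.

End Reflections.

(** * Simple roots and [xi] through fundamental weights *)

Section SimpleRootsOfC.
Variables (F : numFieldType) (l : nat) (l_gt1 : (1 < l)%N).
Implicit Types (i j k : 'I_l.+1) (n m : nat).

Definition fundn n : cartan_dual F l := fund_weight F (inord n).

(** For [n] from 1 to [l] this is the vector epsilon_n of the standard model, where alpha_n =
    epsilon_n - epsilon_(n+1), alpha_l = 2 epsilon_l and alpha_0 = delta - 2 epsilon_1. *)
Definition fund_step n : cartan_dual F l := fundn n - fundn n.-1.

Lemma simple_root_ord0 :
  simple_root F (ord0 : 'I_l.+1) = - 2 *: fund_step 1 + null_root F l.
Proof.
rewrite /fund_step /fundn; apply: weight_eqP => [i|];
    rewrite pairingD pairingZ pairingB.
  rewrite pairing_coroot_root !pairing_coroot_fund pairing_coroot_null // mxE.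
  rewrite -!val_eqE /= !inordK //; last by lia.
  by have := ltn_ord i; do ![case: eqP => //= ?]; first [lia | move=> _; ring].
rewrite pairing_degree_root !pairing_degree_fund pairing_degree_null //.
by rewrite eqxx /=; ring.
Qed.

Lemma simple_root_ord_max :
  simple_root F (ord_max : 'I_l.+1) = 2 *: fund_step l.
Proof.
rewrite /fund_step /fundn; apply: weight_eqP => [i|]; rewrite pairingZ pairingB.
  rewrite pairing_coroot_root !pairing_coroot_fund mxE.
  rewrite -!val_eqE /= !inordK //; last by lia.
  by have := ltn_ord i; do ![case: eqP => //= ?]; first [lia | move=> _; ring].
rewrite pairing_degree_root !pairing_degree_fund -val_eqE /=.
by case: eqP => [|_] /=; [lia | ring].
Qed.

Lemma simple_root_mid n : (0 < n < l)%N ->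
  simple_root F (inord n : 'I_l.+1) = fund_step n - fund_step n.+1.
Proof.
move=> /andP[n_gt0 n_lt]; rewrite /fund_step /fundn.
apply: weight_eqP => [i|]; rewrite !pairingB.
  rewrite pairing_coroot_root !pairing_coroot_fund mxE.
  rewrite -!val_eqE /= !inordK //; try lia.
  by have := ltn_ord i; do ![case: eqP => //= ?]; first [lia | move=> _; ring].
rewrite pairing_degree_root !pairing_degree_fund -val_eqE /= inordK; last by lia.
by case: eqP => [|_] /=; [lia | ring].
Qed.

Lemma sum_simple_roots m n : (0 < m <= n)%N -> (n <= l)%N ->
  \sum_(m <= j < n) simple_root F (inord j : 'I_l.+1) = fund_step m - fund_step n.
Proof.
move=> /andP[m_gt0]; elim: n => [|n IHn]; first by case: m m_gt0.
rewrite leq_eqVlt => /orP[/eqP <- _|]; first by rewrite big_geq // subrr.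
rewrite ltnS => m_le n_lt; rewrite big_nat_recr //= (IHn m_le (ltnW n_lt)).
rewrite simple_root_mid; last by rewrite n_lt (leq_trans m_gt0).
by rewrite addrA subrK.
Qed.

(** Summation by parts: the weights [t] turn differences of steps into a sum of steps, which
    telescopes, and one boundary term. *)
Lemma sum_roots_up k n : (k + n < l)%N ->
  \sum_(1 <= t < n.+1) t%:R *: simple_root F (inord (k + t) : 'I_l.+1) =
  fundn (k + n) - fundn k - n%:R *: fund_step (k + n).+1.
Proof.
elim: n => [|n IHn] n_lt; first by rewrite big_geq // addn0 subrr scale0r subrr.
rewrite big_nat_recr //= IHn; last by lia.
rewrite (addnS k n) simple_root_mid; last by lia.
rewrite [fund_step (k + n).+1]/fund_step /= -natr1; apply/rowP => c.
move: (fundn _) (fundn _) (fundn _) (fund_step _) => x1 x2 x3 x4.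
by rewrite !mxE; ring.
Qed.

Lemma sum_roots_down k n : (n < k)%N ->
  \sum_(1 <= t < n.+1) t%:R *: simple_root F (inord (k - t) : 'I_l.+1) =
  fundn (k - n) - fundn k + n%:R *: fund_step (k - n).
Proof.
elim: n => [|n IHn] n_lt; first by rewrite big_geq // subn0 subrr scale0r addr0.
rewrite big_nat_recr //= (IHn (ltnW n_lt)).
rewrite simple_root_mid; last by have := ltn_ord k; lia.
have -> : (k - n = (k - n.+1).+1)%N by lia.
rewrite [fund_step (k - n.+1).+1]/fund_step /= -natr1; apply/rowP => c.
move: (fundn _) (fundn _) (fundn _) (fund_step _) => x1 x2 x3 x4.
by rewrite !mxE; ring.
Qed.

(** The last simple root cancels the far end of the middle sum. What the boundary term leaves is a
    single step, from [k + n - 1] to [k + n]. *)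
Lemma xi_up k n : (k + n <= l)%N -> xi F k n%:Z = fundn (k + n) - fundn k.
Proof.
case: n => [|n] n_le; first by rewrite addn0 subrr.
rewrite /xi sum_roots_up; last by lia.
rewrite simple_root_ord_max sum_simple_roots; [|lia|lia].
rewrite scalerA divfK ?pnatr_eq0 // (addnS k n) [fund_step (k + n).+1]/fund_step /=.
rewrite -natr1; apply/rowP => c.
move: (fundn _) (fundn _) (fundn _) (fund_step _) => x1 x2 x3 x4.
by rewrite !mxE; ring.
Qed.

(** The mirror image of [xi_up], except that alpha_0 contributes a multiple of the null root. *)
Lemma xi_down k n : (n <= k)%N ->
  xi F k (- n%:Z) = fundn (k - n) - fundn k + (n%:R / 2) *: null_root F l.
Proof.
case: n => [|n] n_le; first by rewrite subn0 subrr mul0r scale0r addr0.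
rewrite -NegzE /xi sum_roots_down // simple_root_ord0.
rewrite sum_simple_roots; [|lia|have := ltn_ord k; lia].
have -> : (k - n = (k - n.+1).+1)%N by lia.
rewrite [fund_step (k - n.+1).+1]/fund_step /= -natr1; apply/rowP => c.
move: (fundn _) (fundn _) (fundn _) (fund_step _) => x1 x2 x3 x4.
move: (null_root _ _) => x5.
by rewrite !mxE; field.
Qed.

End SimpleRootsOfC.

(** * Conjugacy to dominant weights and the maximal weights *)

Section MaximalWeights.
Variables (F : numFieldType) (l : nat) (l_gt1 : (1 < l)%N) (k : 'I_l.+1).
Variables (V : lmodType F) (M : km_module l V).
Hypothesis Mirr : irreducible_module M.
Hypothesis Mhw : highest_weight_module M (fund_weight F k).
Implicit Types (i j : 'I_l.+1) (mu lam : cartan_dual F l) (b : 'cV[int]_l.+1).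

(** Reflecting at a negative label strictly lowers the height of [fund_weight F k - mu], which stays
    nonnegative on weights. *)
Lemma is_weight_dominant_conj mu : is_weight M mu ->
  exists w lam, [/\ weyl_group F l w, is_weight M lam,
    forall i, 0 <= pairing (coroot F i) lam & mu = w lam].
Proof.
move=> mu_wt; have [b b0 muE] := is_weight_cone Mhw mu_wt.
have [n] : exists n : nat, \sum_i b i 0 < n%:Z.
  exists `|(\sum_i b i 0)%R|.+1%N; rewrite intS addrC ltzD1; exact: ler_norm.
elim: n mu b mu_wt b0 muE => [|n IHn] mu b mu_wt b0 muE b_n.
  by move: b_n; rewrite ltNge sumr_ge0.
have [/forallP mu_dom|] := boolP [forall i, 0 <= label k b i].
  exists id, mu; split=> // [|i]; first exact: weyl_id.
  by rewrite muE pairing_label ler0z.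
rewrite negb_forall => /existsP[i]; rewrite -ltNge => lab.
have rmu_wt := is_weight_reflection l_gt1 Mirr Mhw (fund_dominant F k) i mu_wt.
have [c c0 rmuE] := is_weight_cone Mhw rmu_wt.
have cE : c = b + label k b i *: delta_mx i 0.
  apply: (root_comb_inj (F := F) l_gt1); rewrite root_combD root_comb_delta.
  have := rmuE; rewrite /reflection {2}muE pairing_label muE.
  by rewrite -addrA -opprD => /addrI/oppr_inj.
have c_n : \sum_i c i 0 < n%:Z.
  rewrite cE (eq_bigr (fun j => b j 0 + (if j == i then label k b i else 0))).
    rewrite big_split /= -big_mkcond big_pred1_eq /=.
    by rewrite -[n%:Z]addr0 ler_ltD // -ltzD1 addrC -intS.
  by move=> j _; rewrite !mxE andbT; case: eqP => _; rewrite ?mulr1 ?mulr0.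
have [w [lam [w_weyl lam_wt lam_dom lamE]]] := IHn _ c rmu_wt c0 rmuE c_n.
exists (reflection i \o w), lam; split=> //; first exact: weyl_reflection.
by rewrite /= -lamE reflectionK.
Qed.

Lemma is_weight_weyl w mu : weyl_group F l w ->
  is_weight M mu -> is_weight M (w mu).
Proof.
move=> + mu_wt; elim=> [//|i {}w _ w_wt /=].
exact: (is_weight_reflection l_gt1 Mirr Mhw (fund_dominant F k) i w_wt).
Qed.

Lemma fund_sub_null_inj i j (m n : nat) :
  fund_weight F i - m%:R *: null_root F l =
  fund_weight F j - n%:R *: null_root F l -> i = j /\ m = n.
Proof.
move=> ij; split.
  have := congr1 (pairing (coroot F i)) ij; rewrite !pairingB !pairingZ.
  rewrite !pairing_coroot_fund pairing_coroot_null // !mulr0 !subr0 eqxx.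
  by case: eqP => // _ /eqP; rewrite /= oner_eq0.
have := congr1 (pairing (degree F l)) ij; rewrite !pairingB !pairingZ.
rewrite !pairing_degree_fund pairing_degree_null // !mulr1 !sub0r.
by move/oppr_inj/eqP; rewrite eqr_nat => /eqP.
Qed.

(** Adding the null root lowers [z] by one, and the least admissible [z] for given [j] is half the
    truncated difference [j - k]. *)
Lemma max_dominantE lam : (max_weights M `&` dominant_weights F l) lam <->
  exists2 j : 'I_l.+1, odd k = odd j &
    lam = fund_weight F j - ((j - k)./2)%:R *: null_root F l.
Proof.
have dominantP := dominant_weightP l_gt1 Mhw.
split=> [[[lam_wt lam_max] [_ lam_dom]]|[j kj lamE]].
  have /dominantP[j [z [kj zP lamE]]] := conj lam_wt lam_dom.
  exists j => //; have [zE|z_gt] : z = (j - k)./2 \/ ((j - k)./2 < z)%N by lia.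
    by rewrite -zE.
  case: lam_max; case: z z_gt zP lamE => // z z_gt zP ->.
  rewrite -natr1 scalerDl scale1r opprD [_ + (_ - _)]addrA subrK.
  by apply: (proj1 ((dominantP _).2 _)); exists j, z; split=> //; lia.
have /dominantP[lam_wt lam_dom] : exists (j : 'I_l.+1) (z : nat), [/\ odd k = odd j,
    (j <= k + z.*2)%N & lam = fund_weight F j - z%:R *: null_root F l].
  by exists j, (j - k)./2; split=> //; lia.
split; split=> //.
  move=> lamD_wt.
  (* The null root has zero labels, so the shifted weight would be dominant with [z] below the least
     admissible value. *)
  have /dominantP[j' [z [kj' zP lamDE]]] : is_weight M (lam + null_root F l) /\
      forall i, 0 <= pairing (coroot F i) (lam + null_root F l).
    split=> // i; rewrite pairingD pairing_coroot_null // addr0; exact: lam_dom.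
  have [jj' zE] : j = j' /\ (j - k)./2 = z.+1.
    apply: fund_sub_null_inj.
    by rewrite -lamE -natr1 scalerDl scale1r opprD [_ + (_ - _)]addrA -lamDE addrK.
  by rewrite -jj' in zP; lia.
exists (fun i => (i == j)%:R), (- ((j - k)./2)%:Z).
rewrite (bigD1 j) //= big1 ?addr0 => [|i /negPf ->]; last by rewrite scale0r.
by rewrite eqxx scale1r rmorphN /= -pmulrn scaleNr.
Qed.

End MaximalWeights.

Theorem proposition2p8 (F : numFieldType) (l : nat) (hl : (2 <= l)%N)
    (k : 'I_l.+1) (V : lmodType F) (M : km_module l V)
    (Mirr : irreducible_module M)
    (Mhw : highest_weight_module M (fund_weight F k)) :
  max_weights M `&` dominant_weights F l =
    [set mu | exists i : nat, ~~ odd i /\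
       ((k + i <= l)%N /\
          mu = fund_weight F k + xi F k i%:Z - (i%:R / 2) *: null_root F l
        \/ (i <= k)%N /\
          mu = fund_weight F k + xi F k (- i%:Z) - (i%:R / 2) *: null_root F l)]
  /\
  forall mu : cartan_dual F l,
    is_weight M mu <->
    exists w eta (m : nat),
      [/\ weyl_group F l w,
          (max_weights M `&` dominant_weights F l) eta &
          mu = w eta - m%:R *: null_root F l].
Proof.
have halfE (i : nat) : ~~ odd i -> i%:R / 2 = (i./2)%:R :> F.
  move=> i_even; rewrite -{1}(odd_double_half i) (negPf i_even) add0n -muln2.
  by rewrite natrM mulfK ?pnatr_eq0.
have fundE (j : 'I_l.+1) : fund_weight F j = fundn F l j.
  by rewrite /fundn inord_val.
split.
  apply/seteqP; split=> mu.
    move=> /(max_dominantE hl Mhw)[j kj ->].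
    have even_diff m n : odd m = odd n -> (m <= n)%N -> ~~ odd (n - m).
      by move=> mn mn_le; rewrite oddB // mn addbb.
    have [kj_le|/ltnW jk_le] := leqP k j.
      exists (j - k)%N; split; [exact: even_diff|left].
      rewrite xi_up // subnKC ?leq_ord //; split=> //.
      by rewrite halfE ?even_diff // !fundE [fundn F l k + _]addrC subrK.
    (* The null root term of [xi_down] cancels the subtracted one, in agreement with the truncated
       [j - k] being 0. *)
    exists (k - j)%N; split; [exact: even_diff|right].
    rewrite xi_down // ?leq_subr // subKn //; split=> //.
    rewrite !fundE addrA addrK [fundn F l k + _]addrC subrK.
    by rewrite (eqP jk_le) scale0r subr0.
  move=> [i [i_even imu]]; apply/(max_dominantE hl Mhw).
  case: imu => -[ki ->].
    exists (inord (k + i)); rewrite inordK //.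
      by rewrite oddD (negPf i_even) addbF.
    rewrite xi_up // halfE // addKn !fundE inordK //.
    by rewrite [fundn F l k + _]addrC subrK.
  have ki_lt : (k - i < l.+1)%N by have := ltn_ord k; lia.
  exists (inord (k - i)); rewrite inordK ?oddB ?(negPf i_even) ?addbF //.
  rewrite xi_down // !fundE inordK // addrA addrK [fundn F l k + _]addrC subrK.
  by rewrite (_ : k - i - k = 0)%N ?scale0r ?subr0 //; lia.
have dominantP := dominant_weightP hl Mhw.
move=> mu; split=> [mu_wt|[w [eta [m [w_weyl eta_max ->]]]]].
  have [w [lam [w_weyl lam_wt lam_dom ->]]] :=
    is_weight_dominant_conj hl Mirr Mhw mu_wt.
  have /dominantP[j [z [kj zP ->]]] := conj lam_wt lam_dom.
  (* The surplus of [z] over its least value becomes [m]; it passes through [w] because the null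
     root is fixed. *)
  exists w, (fund_weight F j - ((j - k)./2)%:R *: null_root F l).
  exists (z - (j - k)./2)%N.
  split=> //; first by apply/(max_dominantE hl Mhw); exists j.
  rewrite -weyl_sub_null // -addrA -opprD -scalerDl -natrD subnKC //; lia.
(* Inside [w], subtracting the null root only increases [z], which preserves admissibility. *)
rewrite -weyl_sub_null //; apply: (is_weight_weyl hl Mirr Mhw) => //.
have /(max_dominantE hl Mhw)[j kj ->] := eta_max.
rewrite -addrA -opprD -scalerDl -natrD.
apply: (proj1 ((dominantP _).2 _)).
by exists j, ((j - k)./2 + m)%N; split=> //; lia.
Qed.
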